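(* Let $v \ge k \ge 2$ be integers, $\lambda$ a positive integer, $V=\mathbb{F}_2^v$, and let $\mathcal{B}$ be a set of $k$-dimensional subspaces of $V$ such that every $2$-dimensional subspace of $V$ is contained in exactly $\lambda$ members of $\mathcal{B}$ (i.e. $(V,\mathcal{B})$ is a simple $2$-$(v,k,\lambda)_2$ subspace design). For $B\in\mathcal{B}$ let $\mathcal{F}_B=\{x+B : x\in V\}$ be the set of the $2^{v-k}$ cosets (affine flats) of $B$ in $V$. Then $\left(V, \bigcup_{B\in\mathcal{B}}\mathcal{F}_B\right)$, whose point set consists of the $2^v$ vectors of $V$ and whose blocks are these flats (each of size $2^k$), is a combinatorial $3$-$(2^v,2^k,\lambda)$ design, i.e. every $3$-element subset of $V$ is contained in exactly $\lambda$ of these blocks.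
   Context: A combinatorial $t$-$(v,k,\lambda)$ design on a finite set $X$ of size $v$ is a collection of $k$-element subsets (blocks) of $X$ such that every $t$-element subset of $X$ is contained in exactly $\lambda$ blocks. A $t$-$(v,k,\lambda)_q$ subspace design on $V=\mathbb{F}_q^v$ is a collection $\mathcal{B}$ of $k$-dimensional subspaces of $V$ such that every $t$-dimensional subspace of $V$ is contained in exactly $\lambda$ members of $\mathcal{B}$; it is simple if $\mathcal{B}$ is a set (no repeated blocks), as assumed throughout the paper. *)

(* Defs.v *)
From HB Require Import structures.
From mathcomp Require Import all_boot all_order all_algebra all_field.

Set Implicit Arguments.
Unset Strict Implicit.
Unset Printing Implicit Defensive.

Import GRing.Theory VectorInternalTheory.
Local Open Scope ring_scope.

(* A subspace is represented by its canonical generating matrix, so over a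
   finite field the subspaces of a finite-dimensional space form a finType. *)
HB.instance Definition _ (F : finFieldType) (vT : vectType F) :=
  [Finite of {vspace vT} by <:].

Definition is_design (X : finType) (t v k lambda : nat) (D : {set {set X}})
    : Prop :=
  [/\ #|X| = v,
      forall A : {set X}, A \in D -> #|A| = k
    & forall T : {set X}, #|T| = t ->
        #|[set A in D | T \subset A]| = lambda].

Definition is_subspace_design (F : finFieldType) (t v k lambda : nat)
    (B : {set {vspace 'rV[F]_v}}) : Prop :=
  (forall U : {vspace 'rV[F]_v}, U \in B -> \dim U = k) /\
  (forall T : {vspace 'rV[F]_v}, \dim T = t ->
     #|[set U in B | (T <= U)%VS]| = lambda).

Definition coset_flat (F : finFieldType) (v : nat) (x : 'rV[F]_v)
    (U : {vspace 'rV[F]_v}) : {set 'rV[F]_v} :=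
  [set x + u | u in U].

Definition flats (F : finFieldType) (v : nat) (U : {vspace 'rV[F]_v})
    : {set {set 'rV[F]_v}} :=
  [set coset_flat x U | x : 'rV[F]_v].

Lemma mem_coset_flat (F : finFieldType) (v : nat) (x y : 'rV[F]_v)
    (U : {vspace 'rV[F]_v}) : (y \in coset_flat x U) = (y - x \in U).
Proof.
apply/imsetP/idP => [[u Uu ->]|Uyx]; first by rewrite addrC addKr.
by exists (y - x); rewrite // addrC subrK.
Qed.

Lemma card_coset_flat (F : finFieldType) (v : nat) (x : 'rV[F]_v)
    (U : {vspace 'rV[F]_v}) : #|coset_flat x U| = (#|F| ^ \dim U)%N.
Proof. by rewrite card_imset ?card_vspace //; apply: addrI. Qed.

Lemma card_flats (F : finFieldType) (v : nat) (U : {vspace 'rV[F]_v}) :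
  #|flats U| = (#|F| ^ (v - \dim U))%N.
Proof.
have partU : partition (flats U) [set: 'rV[F]_v].
  apply/and3P; split.
  - rewrite eqEsubset subsetT; apply/subsetP => x _; apply/bigcupP.
    exists (coset_flat x U); first exact: imset_f.
    by rewrite mem_coset_flat subrr mem0v.
  - apply/trivIsetP => _ _ /imsetP[x _ ->] /imsetP[y _ ->].
    apply: contraR => /pred0Pn[z /andP[]] /=; rewrite !mem_coset_flat => zx zy.
    apply/eqP/setP => w; rewrite !mem_coset_flat.
    by rewrite -(subrKA z w (- x)) -(subrKA z w (- y)) (rpredDr _ zx) (rpredDr _ zy).
  - apply/negP => /imsetP[x _ /setP/(_ x)].
    by rewrite mem_coset_flat subrr mem0v inE.
have F_gt0 : (0 < #|F| ^ \dim U)%N by rewrite expn_gt0 ltnW ?finNzRing_gt1.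
have dimU : (\dim U <= v)%N
  by have := dimvS (subvf U); rewrite dimvf dim_matrix GRing.mul1r.
apply/eqP; rewrite -(eqn_pmul2r F_gt0) -expnD subnK //; apply/eqP.
rewrite -(card_uniform_partition _ partU); first by rewrite cardsT card_mx mul1n.
by move=> _ /imsetP[x _ ->]; rewrite card_coset_flat.
Qed.

(* Main.v *)
Require Import Defs.
From mathcomp Require Import all_boot all_order all_algebra all_field.

(** Fix three distinct points x, y, z.  A flat through them is x + U with U a
    block containing y - x and z - x.  Over F_2 these two differences, being
    nonzero and distinct, are linearly independent, so they span a plane, which
    lies in exactly lambda blocks; and U is recovered from x + U and x. *)

Lemma cards3_ex (T : finType) (A : {set T}) :
  #|A| = 3 -> exists x y z, [/\ x != y, x != z, y != z & A = [set x; y; z]].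
Proof.
move=> A3; have /card_gt0P[x Ax] : 0 < #|A| by rewrite A3.
have /cards2P[y [z [yz defA]]] : #|A :\ x| == 2.
  by have := cardsD1 x A; rewrite A3 Ax add1n => -[<-].
have yA : y \in A :\ x by rewrite defA set21.
have zA : z \in A :\ x by rewrite defA set22.
move: yA zA; rewrite !inE => /andP[yx _] /andP[zx _].
exists x, y, z; split; rewrite // 1?eq_sym //.
by rewrite -setUA -defA setD1K.
Qed.

Section Flats.

Import GRing.Theory.
Local Open Scope ring_scope.

(** The only scalars are 0 and 1, so the line through [b] contains just 0 and [b], and [a] is
    neither. *)
Lemma free_pair_F2 (vT : vectType 'F_2) (a b : vT) :
  a != 0 -> b != 0 -> a != b -> free [:: a; b].
Proof.
move=> a0 b0 ab; rewrite free_cons free_cons span_nil memv0 b0 nil_free span_seq1 /= andbT.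
apply/vlineP => -[c ac]; have /orP[/eqP c0|/eqP c1] : (c == 0) || (c == 1).
- by case: c {ac} => [[|[|m]] lt_m2].
- by rewrite ac c0 scale0r eqxx in a0.
- by rewrite ac c1 scale1r eqxx in ab.
Qed.

Variables (F : finFieldType) (v : nat).
Implicit Types (x y : 'rV[F]_v) (U : {vspace 'rV[F]_v}) (A : {set 'rV[F]_v}).
Implicit Types (B : {set {vspace 'rV[F]_v}}).

Lemma coset_flat_inj x : injective (@coset_flat F v x).
Proof.
move=> U W eqUW; apply/vspaceP => u.
(* [x + u] lies in a flat based at [x] exactly when [u] lies in its direction. *)
by move/setP/(_ (x + u)): eqUW; rewrite !mem_coset_flat addrC addrA addNr add0r.
Qed.

(** Any point of a coset can serve as its base point; this lets all flats through [x] be based at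
    [x]. *)
Lemma flats_mem U A x : A \in flats U -> x \in A -> A = coset_flat x U.
Proof.
case/imsetP => y _ ->; rewrite mem_coset_flat => Uxy.
(* Split [w - y] as [(w - x) + (x - y)], whose second summand is in [U]. *)
apply/setP => w; rewrite !mem_coset_flat -(subrKA x w (- y)).
by rewrite (rpredDr _ Uxy).
Qed.

(** Turns counting flats into counting blocks above a fixed span. *)
Lemma flats_through x y z B :
  [set A in \bigcup_(U in B) flats U | [set x; y; z] \subset A] =
  [set coset_flat x U | U in [set U in B | (<<[:: (y - x)%R; (z - x)%R]>> <= U)%VS]].
Proof.
have subP U : (<<[:: y - x; z - x]>> <= U)%VS = (y - x \in U) && (z - x \in U).
  by rewrite span_cons span_seq1 subv_add !memvE.
apply/setP => A; rewrite inE !subUset !sub1set; apply/andP/imsetP.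
- case=> /bigcupP[U BU UA] /andP[/andP[Ax Ay] Az].
  have defA := flats_mem U A x UA Ax.
  by exists U => //; rewrite inE BU subP -!mem_coset_flat -defA Ay Az.
- case=> U; rewrite inE subP => /andP[BU /andP[Uy Uz]] ->.
  split; first by apply/bigcupP; exists U => //; apply: imset_f.
  by rewrite !mem_coset_flat subrr mem0v Uy Uz.
Qed.

End Flats.

Theorem theorem2 (v k lambda : nat) (hk : 2 <= k) (hkv : k <= v)
    (hlambda : 0 < lambda) (B : {set {vspace 'rV['F_2]_v}})
    (hB : is_subspace_design 2 k lambda B) :
  is_design 3 (2 ^ v) (2 ^ k) lambda (\bigcup_(U in B) flats U).
Proof.
have [dimB cardB] := hB; split.
- by rewrite card_mx card_Fp // mul1n.
- by move=> A /bigcupP[U BU /imsetP[x _ ->]]; rewrite card_coset_flat card_Fp // dimB.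
move=> T /cards3_ex[x [y [z [xy xz yz ->]]]].
rewrite flats_through card_imset; last exact: coset_flat_inj.
(* [free] unfolds to the span having dimension equal to the list length, here 2, as [cardB]
   requires. *)
apply/cardB/eqP/free_pair_F2.
- by rewrite GRing.subr_eq0 eq_sym.
- by rewrite GRing.subr_eq0 eq_sym.
- by rewrite (can_eq (GRing.subrK x)).
Qed.
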